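(* For $n\ge 1$ let $f_n$, $t_n$, $u_n$ be the numbers of rows with the value false, true and unknown, respectively, in the Kleene truth tables of all bracketed implications with $n$ distinct variables $p_1,\dots,p_n$, and let $g_n$ be the total number of rows in all these truth tables. Then, as $n\to\infty$, $$f_n\sim\left(\frac{7-2\sqrt7}{21}\right)\frac{3\cdot 12^{n-1}}{\sqrt{\pi n^3}},\qquad t_n\sim\left(\frac{7+2\sqrt7}{21}\right)\frac{3\cdot 12^{n-1}}{\sqrt{\pi n^3}},$$ $$u_n\sim\left(\frac13\right)\frac{3\cdot 12^{n-1}}{\sqrt{\pi n^3}},\qquad g_n\sim\frac{3\cdot 12^{n-1}}{\sqrt{\pi n^3}}.$$
   Context: Truth values are $1$ (true), $0$ (false), $2$ (unknown). The Kleene implication on $\{0,1,2\}$ is: $1\Rightarrow 1=1$, $1\Rightarrow 0=0$, $1\Rightarrow 2=2$; $0\Rightarrow b=1$ for every $b$; $2\Rightarrow 1=1$, $2\Rightarrow 0=2$, $2\Rightarrow 2=2$. A bracketed formula (bracketed implication) with $n$ distinct variables is a formula obtained from $p_1\Rightarrow p_2\Rightarrow\cdots\Rightarrow p_n$ by a complete bracketing (equivalently, a full binary tree with $n$ leaves labelled $p_1,\dots,p_n$ from left to right and every internal node labelled $\Rightarrow$); for $n=1$ the only one is $p_1$. A row of the truth table of such a formula is an assignment of $\{0,1,2\}$-values to $p_1,\dots,p_n$, and its value is the value of the formula under this assignment. Counting rows in all truth tables means counting pairs (bracketed formula, assignment). The notation $a_n\sim b_n$ means $a_n/b_n\to1$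 as $n\to\infty$. *)

(* Defs.v *)
From HB Require Import structures.
From mathcomp Require Import all_boot all_order all_algebra.
From mathcomp Require Import all_classical all_reals all_analysis.

Set Implicit Arguments.
Unset Strict Implicit.
Unset Printing Implicit Defensive.

Import Order.TTheory GRing.Theory Num.Theory.
Import numFieldNormedType.Exports.

Local Open Scope classical_set_scope.
Local Open Scope ring_scope.

Variant kleene := KFalse | KTrue | KUnknown.

Definition option_of_kleene (a : kleene) : option bool :=
  match a with
  | KFalse => Some false
  | KTrue => Some true
  | KUnknown => None
  end.

Definition kleene_of_option (o : option bool) : kleene :=
  match o with
  | Some false => KFalse
  | Some true => KTrue
  | None => KUnknown
  end.

Lemma option_of_kleeneK : cancel option_of_kleene kleene_of_option.
Proof. by case. Qed.

HB.instance Definition _ := Finite.copy kleene (can_type option_of_kleeneK).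

Definition kimp (a b : kleene) : kleene :=
  match a, b with
  | KTrue, b => b
  | KFalse, _ => KTrue
  | KUnknown, KTrue => KTrue
  | KUnknown, _ => KUnknown
  end.

Inductive formula (V : Type) : Type :=
  | Var of V
  | Imp of formula V & formula V.

Fixpoint leaves (V : Type) (A : formula V) : seq V :=
  match A with
  | Var p => [:: p]
  | Imp B C => leaves B ++ leaves C
  end.

Fixpoint eval (V : Type) (v : V -> kleene) (A : formula V) : kleene :=
  match A with
  | Var p => v p
  | Imp B C => kimp (eval v B) (eval v C)
  end.

Fixpoint tree_of_formula (V : Type) (A : formula V) : GenTree.tree V :=
  match A with
  | Var p => GenTree.Leaf p
  | Imp B C => GenTree.Node 0 [:: tree_of_formula B; tree_of_formula C]
  end.

Fixpoint formula_of_tree (V : Type) (t : GenTree.tree V) : option (formula V) :=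
  match t with
  | GenTree.Leaf p => Some (Var p)
  | GenTree.Node 0 [:: l; r] =>
      match formula_of_tree l, formula_of_tree r with
      | Some B, Some C => Some (Imp B C)
      | _, _ => None
      end
  | _ => None
  end.

Lemma tree_of_formulaK (V : Type) :
  pcancel (@tree_of_formula V) (@formula_of_tree V).
Proof. by elim=> //= B -> C ->. Qed.

HB.instance Definition _ (V : countType) :=
  Countable.copy (formula V) (pcan_type (@tree_of_formulaK V)).

(* The index i : 'I_n stands for the variable p_{i+1}; [enum 'I_n] lists the
   indices in increasing order. *)
Definition bracketed (n : nat) : Type :=
  {A : formula 'I_n | leaves A == enum 'I_n}.

HB.instance Definition _ (n : nat) := Countable.on (bracketed n).

(* The formulas whose leaf sequence is [s], provided [size s <= k]; this is only
   used to show that [bracketed n] is finite. *)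
Fixpoint bracketings (V : Type) (k : nat) (s : seq V) : seq (formula V) :=
  if k is k'.+1 then
    (if s is [:: p] then [:: Var p] else [::]) ++
    flatten [seq [seq Imp B C | B <- bracketings k' (take i s),
                                C <- bracketings k' (drop i s)]
            | i <- iota 1 (size s).-1]
  else [::].

Lemma leaves_gt0 (V : Type) (A : formula V) : (0 < size (leaves A))%N.
Proof. by elim: A => //= B IB C _; rewrite size_cat ltn_addr. Qed.

Lemma mem_bracketings (V : countType) (k : nat) (A : formula V) :
  (size (leaves A) <= k)%N -> A \in bracketings k (leaves A).
Proof.
elim: k A => [|k IHk] A; first by rewrite leqNgt leaves_gt0.
case: A => [p|B C] /= hs; first by rewrite inE eqxx.
have hB := leaves_gt0 B; have hC := leaves_gt0 C.
rewrite size_cat in hs.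
have ltB : (size (leaves B) < size (leaves B) + size (leaves C))%N.
  by rewrite -addn1 leq_add2l.
have ltC : (size (leaves C) < size (leaves B) + size (leaves C))%N.
  by rewrite -add1n leq_add2r.
rewrite mem_cat; apply/orP; right; apply/flatten_mapP.
exists (size (leaves B)).
  by rewrite mem_iota hB size_cat /= add1n prednK// (ltn_trans hB ltB).
rewrite take_size_cat// drop_size_cat//; apply/allpairsP; exists (B, C) => /=.
by split=> //; apply: IHk; rewrite -ltnS; apply: leq_trans hs.
Qed.

Definition bracketed_enum (n : nat) : seq (bracketed n) :=
  undup (pmap insub (bracketings n (enum 'I_n))).

Lemma bracketed_enumP (n : nat) : Finite.axiom (bracketed_enum n).
Proof.
move=> A; rewrite count_uniq_mem ?undup_uniq// mem_undup mem_pmap_sub /=.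
case: A => A /= /eqP hA.
by rewrite -[in X in bracketings _ X]hA mem_bracketings// hA size_enum_ord.
Qed.

HB.instance Definition _ (n : nat) :=
  fintype.isFinite.Build (bracketed n) (@bracketed_enumP n).

Definition truth_row (n : nat) : finType := (bracketed n * {ffun 'I_n -> kleene})%type.

Definition row_value (n : nat) (r : truth_row n) : kleene := eval r.2 (val r.1).

Definition count_rows (n : nat) (a : kleene) : nat :=
  #|[set r : truth_row n | row_value r == a]%SET|.

Definition f_ (n : nat) : nat := count_rows n KFalse.
Definition t_ (n : nat) : nat := count_rows n KTrue.
Definition u_ (n : nat) : nat := count_rows n KUnknown.
Definition g_ (n : nat) : nat := #|truth_row n|.

Definition asymptotic (R : realType) (a b : nat -> R) : Prop :=
  (a n / b n) @[n --> \oo] --> (1 : R).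

(* Main.v *)
(* A row is a full binary tree with truth values at its leaves, so the counts
   satisfy convolution recurrences; in particular g is 3^n times a Catalan number
   and u = g / 3.  Put a n = g (n+1) / 12^(n+1), and let f n, t n be the scaled
   counts of false and true rows.  The sum of a is 1/2 and a (n-i) / a n tends to 1,
   so in the convolution of a with itself the terms with both indices large carry
   asymptotically no mass.  Hence f (n+1) = sum t i * f (n-i) is governed by the two
   ends of the sum, and since t + f = (2/3) a the error |f n / a n - c| is
   contracted asymptotically by a factor 1/3, where c is determined by the sum of f,
   a root of a quadratic equation.  The growth of a is Wallis's formula. *)
Require Import Defs.
From HB Require Import structures.
From mathcomp Require Import all_boot all_order all_algebra.
From mathcomp Require Import all_classical all_reals all_analysis.
From mathcomp Require Import zify ring lra.

Set Implicit Arguments.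
Unset Strict Implicit.
Unset Printing Implicit Defensive.

Import Order.TTheory GRing.Theory Num.Theory.
Import numFieldNormedType.Exports.
(* Analysis shadows [eval]. *)
Import Defs.

(** * Convolution recurrences *)

Fixpoint map_formula (V W : Type) (h : V -> W) (A : formula V) : formula W :=
  match A with
  | Var p => Var (h p)
  | Imp B C => Imp (map_formula h B) (map_formula h C)
  end.

Lemma leaves_map_formula (V W : Type) (h : V -> W) (A : formula V) :
  leaves (map_formula h A) = map h (leaves A).
Proof. by elim: A => //= B -> C ->; rewrite map_cat. Qed.

Lemma eval_map_formula (V W : Type) (v : W -> kleene) (h : V -> W) (A : formula V) :
  eval v (map_formula h A) = eval (v \o h) A.
Proof. by elim: A => //= B -> C ->. Qed.

(** The common image fixes the shape of the tree and the leaf sequence fixes its labels. Equality of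
    the images gives left subtrees of equal size, so the concatenated leaf sequences split at the
    same place. *)
Lemma map_formula_leaves_inj (V : eqType) (W : Type) (h k : V -> W) (A B : formula V) :
  map_formula h A = map_formula k B -> leaves A = leaves B -> A = B.
Proof.
elim: A B => [p|A1 IH1 A2 IH2] [q|B1 B2] //=; first by move=> _ [->].
case=> e1 e2 /eqP.
have /eqP := congr1 (size \o @leaves W) e1.
rewrite /= !leaves_map_formula !size_map => /eqP es.
by rewrite eqseq_cat// => /andP[/eqP l1 /eqP l2]; rewrite (IH1 _ e1 l1) (IH2 _ e2 l2).
Qed.

Lemma map_formula_lift (V W : Type) (h : V -> W) (B : formula W) (s : seq V) :
  map h s = leaves B -> exists2 A, leaves A = s & map_formula h A = B.
Proof.
elim: B s => [p|B1 IH1 B2 IH2] s /=.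
  by case: s => [//|q [|//]] [<-]; exists (Var q).
move=> e.
have e1 : map h (take (size (leaves B1)) s) = leaves B1.
  by rewrite map_take e take_size_cat.
have e2 : map h (drop (size (leaves B1)) s) = leaves B2.
  by rewrite map_drop e drop_size_cat.
have [A1 l1 <-] := IH1 _ e1; have [A2 l2 <-] := IH2 _ e2.
by exists (Imp A1 A2) => //=; rewrite l1 l2 cat_take_drop.
Qed.

(* Since every variable occurs exactly once, a row amounts to a formula whose
   leaves carry truth values. *)
Definition row_formula (n : nat) (r : truth_row n) : formula kleene :=
  map_formula r.2 (val r.1).

Definition valued_formulas (n : nat) : seq (formula kleene) :=
  [seq row_formula r | r : truth_row n].

Lemma row_formula_inj (n : nat) : injective (@row_formula n).
Proof.
move=> [[A hA] v] [[B hB] w]; rewrite /row_formula /= => e.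
have eAB : A = B.
  by apply: (map_formula_leaves_inj e); rewrite (eqP hA) (eqP hB).
subst B; congr pair; first exact: val_inj.
have := congr1 (@leaves kleene) e; rewrite !leaves_map_formula (eqP hA) => /eq_in_map evw.
by apply/ffunP => i; apply: evw; rewrite mem_enum.
Qed.

Lemma valued_formulas_uniq (n : nat) : uniq (valued_formulas n).
Proof. by rewrite map_inj_uniq ?enum_uniq//; apply: row_formula_inj. Qed.

(** Together with uniqueness this turns row counting into counting trees with truth values at the
    leaves, where membership depends on the number of leaves alone. *)
Lemma mem_valued_formulas (n : nat) (B : formula kleene) :
  (B \in valued_formulas n) = (size (leaves B) == n).
Proof.
apply/fintype.imageP/eqP => [[[[A hA] v] _ ->]|sB].
  by rewrite /row_formula /= leaves_map_formula (eqP hA) size_map size_enum_ord.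
pose v : {ffun 'I_n -> kleene} := [ffun i : 'I_n => nth KFalse (leaves B) i].
have ev : map v (enum 'I_n) = leaves B.
  apply: (@eq_from_nth _ KFalse); first by rewrite size_map size_enum_ord.
  move=> i; rewrite size_map size_enum_ord => lt_in.
  by rewrite (nth_map (Ordinal lt_in)) ?size_enum_ord// ffunE nth_enum_ord.
have [A lA <-] := map_formula_lift ev.
by exists (exist _ A (introT eqP lA), v).
Qed.

Lemma count_rowsE (n : nat) (a : kleene) :
  count_rows n a = count (fun B => eval id B == a) (valued_formulas n).
Proof.
rewrite /count_rows cardsE cardE size_filter count_map -enumT.
by apply: eq_count => r; rewrite /= /row_formula eval_map_formula.
Qed.

Lemma g_E (n : nat) : g_ n = size (valued_formulas n).
Proof. by rewrite size_map -cardE. Qed.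

Lemma valued_formulas1 :
  perm_eq (valued_formulas 1) [:: Var KFalse; Var KTrue; Var KUnknown].
Proof.
apply: uniq_perm => //; first exact: valued_formulas_uniq.
move=> B; rewrite mem_valued_formulas; case: B => [[]|B C] //=.
rewrite size_cat !inE /=; have := leaves_gt0 B; have := leaves_gt0 C.
by case: (size _) => // k; case: (size _) => // l; rewrite addnS.
Qed.

(** Decomposition at the root. The blocks are disjoint because the number of leaves of the left
    subtree determines [i]. *)
Lemma valued_formulasSS (n : nat) :
  perm_eq (valued_formulas n.+2)
    (flatten [seq [seq Imp B C | B <- valued_formulas i.+1,
                                 C <- valued_formulas (n - i).+1] | i <- iota 0 n.+1]).
Proof.
have memP i B : reflect
    (exists p, [/\ p.1 \in valued_formulas i.+1, p.2 \in valued_formulas (n - i).+1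
                 & B = Imp p.1 p.2])
    (B \in [seq Imp B C | B <- valued_formulas i.+1, C <- valued_formulas (n - i).+1]).
  exact: allpairsP.
apply: uniq_perm; first exact: valued_formulas_uniq.
  elim: (iota 0 n.+1) (iota_uniq 0 n.+1) => //= i s IHs /andP[nis us].
  rewrite cat_uniq IHs// andbT; apply/andP; split.
    apply: allpairs_uniq; try exact: valued_formulas_uniq.
    by move=> [B C] [B' C'] _ _ /= [-> ->].
  apply/hasPn => B /flatten_mapP[j js /memP[[C D] /= [hC _ ->]]].
  apply/negP => /memP[[C' D'] /= [hC' _ [eC _]]]; subst C'.
  move: hC hC'; rewrite !mem_valued_formulas => /eqP -> /eqP[eij].
  by rewrite -eij js in nis.
move=> B; rewrite mem_valued_formulas; apply/idP/flatten_mapP.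
  case: B => [//|C D] /=; rewrite size_cat => /eqP e.
  have {}e : size (leaves C) + size (leaves D) = n.+2 := e.
  have := leaves_gt0 C; have := leaves_gt0 D => hD hC.
  exists (size (leaves C)).-1; first by rewrite (mem_iota 0 n.+1); lia.
  apply/memP; exists (C, D) => /=; rewrite !mem_valued_formulas.
  split=> //; apply/eqP; first by rewrite prednK.
  have -> : (n - (size (leaves C)).-1).+1 = size (leaves D) by lia.
  by [].
move=> [i]; rewrite (mem_iota 0 n.+1) => hi /memP[[C D] /=].
rewrite !mem_valued_formulas => -[/eqP hC /eqP hD ->] /=.
by rewrite size_cat hC hD; apply/eqP; lia.
Qed.

Lemma count_valued_formulasSS (P : pred (formula kleene)) (n : nat) :
  count P (valued_formulas n.+2) =
  \sum_(i < n.+1) \sum_(B <- valued_formulas i.+1)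
    \sum_(C <- valued_formulas (n - i).+1) P (Imp B C).
Proof.
rewrite (permP (valued_formulasSS n)) count_flatten sumnE !big_map -val_enum_ord big_map.
rewrite big_enum /=; apply: eq_bigr => i _.
rewrite count_flatten sumnE !big_map; apply: eq_bigr => B _.
by rewrite count_map -sum1_count big_mkcond; apply: eq_bigr => C _ /=; case: (P _).
Qed.

Lemma sum_count_pair (T : Type) (p q : pred T) (s t : seq T) :
  \sum_(x <- s) \sum_(y <- t) (p x && q y) = count p s * count q t.
Proof.
have cnt (r : pred T) (l : seq T) : count r l = \sum_(x <- l) r x.
  by rewrite -sum1_count big_mkcond; apply: eq_bigr => x _; case: (r x).
rewrite !cnt big_distrlr /=; apply: eq_bigr => x _; apply: eq_bigr => y _.
by rewrite mulnb.
Qed.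

Lemma f_1 : f_ 1 = 1.
Proof. by rewrite /f_ count_rowsE (permP valued_formulas1). Qed.

Lemma u_1 : u_ 1 = 1.
Proof. by rewrite /u_ count_rowsE (permP valued_formulas1). Qed.

Lemma g_1 : g_ 1 = 3.
Proof. by rewrite g_E (perm_size valued_formulas1). Qed.

Lemma g_sum (n : nat) : g_ n = f_ n + t_ n + u_ n.
Proof.
rewrite g_E /f_ /t_ /u_ !count_rowsE; elim: (valued_formulas n) => //= B s ->.
by case: (eval id B) => /=; lia.
Qed.

(** An implication is false exactly when its premise is true and its conclusion false. *)
Lemma f_SS (n : nat) : f_ n.+2 = \sum_(i < n.+1) t_ i.+1 * f_ (n - i).+1.
Proof.
rewrite /f_ count_rowsE count_valued_formulasSS; apply: eq_bigr => i _.
rewrite /t_ !count_rowsE -sum_count_pair.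
apply: eq_bigr => B _; apply: eq_bigr => C _ /=.
by case: (eval id B); case: (eval id C).
Qed.

Lemma g_SS (n : nat) : g_ n.+2 = \sum_(i < n.+1) g_ i.+1 * g_ (n - i).+1.
Proof.
rewrite g_E -count_predT count_valued_formulasSS; apply: eq_bigr => i _.
by rewrite !g_E -!count_predT -sum_count_pair.
Qed.

(** The value unknown arises from true and unknown, unknown and false, or unknown and unknown. *)
Lemma u_SS (n : nat) : u_ n.+2 = \sum_(i < n.+1) u_ i.+1 * g_ (n - i).+1.
Proof.
transitivity (\sum_(i < n.+1) (t_ i.+1 * u_ (n - i).+1 +
                               u_ i.+1 * (f_ (n - i).+1 + u_ (n - i).+1))).
  rewrite /u_ count_rowsE count_valued_formulasSS; apply: eq_bigr => i _.
  rewrite mulnDr /t_ /f_ !count_rowsE -!sum_count_pair -!big_split /=.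
  apply: eq_bigr => B _; rewrite -!big_split /=; apply: eq_bigr => C _ /=.
  by case: (eval id B); case: (eval id C).
(* Reversing the index turns [t * u] into [u * t], so that the cofactors of [u] add up to [g]. *)
rewrite big_split /= (reindex_inj rev_ord_inj) -big_split /=; apply: eq_bigr => i _.
rewrite g_sum subSS subKn; last by have := ltn_ord i; lia.
by lia.
Qed.

(** Both recurrences convolve with [g], so the ratio 3 at [n = 1] propagates through the left
    factor. *)
Lemma g_eq3u (n : nat) : 0 < n -> g_ n = 3 * u_ n.
Proof.
elim/ltn_ind: n => -[//|[|n]] IH _; first by rewrite g_1 u_1.
rewrite g_SS u_SS big_distrr /=; apply: eq_bigr => i _.
by rewrite IH ?mulnA//; have := ltn_ord i; lia.
Qed.

Local Open Scope classical_set_scope.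
Local Open Scope ring_scope.

(** * Wallis bounds *)

(* An explicit antiderivative of sin ^+ n vanishing at 0: its values at pi / 2 are
   the Wallis integrals, obtained without integration. *)
Fixpoint sin_primitive {R : realType} (n : nat) (x : R) : R :=
  match n with
  | 0 => x
  | 1 => 1 - cos x
  | m.+2 => (m.+1%:R * sin_primitive m x - sin x ^+ m.+1 * cos x) / m.+2%:R
  end.

Lemma is_derive_sin_primitive (R : realType) (n : nat) (x : R) :
  is_derive x 1 (sin_primitive n : R -> R) (sin x ^+ n).
Proof.
elim/ltn_ind: n => -[|[|n]] IH.
- by rewrite expr0; apply: is_derive_id.
- rewrite expr1 -[sin x]opprK -[- - _]sub0r.
  have -> : sin_primitive 1 = cst 1 - @cos R by apply/funext.
  exact: is_deriveB.
have h := IH n (ltnW (ltnSn _)).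
have -> : sin_primitive n.+2 =
    n.+2%:R^-1 \*: (n.+1%:R \*: @sin_primitive R n - (@sin R) ^+ n.+1 * @cos R).
  by apply/funext => y; rewrite /= /GRing.scale /= mulrC !fctE.
apply: is_derive_eq.
rewrite /GRing.scale /= fctE exprS.
have e : cos x * cos x = 1 - sin x * sin x by rewrite -!expr2 cos2sin2.
(* The term produced by differentiating the power of sine; replacing the squared cosine by one minus
   the squared sine leaves only powers of sine. *)
rewrite (_ : cos x * _ = n.+1%:R * sin x ^+ n * (cos x * cos x)); last by ring.
rewrite e 2!exprS; field.
by rewrite -natrD pnatr_eq0.
Qed.

Lemma sin_primitive0 (R : realType) (n : nat) : sin_primitive n (0 : R) = 0.
Proof.
elim/ltn_ind: n => -[|[|n]] IH //=; first by rewrite cos0 subrr.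
by rewrite IH ?(ltnW (ltnSn _))// sin0 expr0n /= mul0r mulr0 subrr mul0r.
Qed.

Definition wallis {R : realType} (n : nat) : R := sin_primitive n (pi / 2).

Lemma wallisSS (R : realType) (n : nat) :
  wallis n.+2 = n.+1%:R / n.+2%:R * wallis n :> R.
Proof. by rewrite /wallis /= cos_pihalf mulr0 subr0 mulrAC. Qed.

(** The difference [h] of the primitives vanishes at 0, and its derivative
    [sin x ^+ n * (sin x - 1)] is nonpositive between 0 and [pi / 2]. *)
Lemma wallis_nincr (R : realType) (n : nat) : wallis n.+1 <= wallis n :> R.
Proof.
have pi2 : 0 <= pi / 2 :> R by rewrite divr_ge0// pi_ge0.
pose h : R -> R := @sin_primitive R n.+1 - @sin_primitive R n.
have dh (x : R) : is_derive x 1 h (sin x ^+ n.+1 - sin x ^+ n).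
  by apply: is_deriveB; apply: is_derive_sin_primitive.
have : h (pi / 2) <= h 0.
  apply: (@ler0_derive1_le_cc R h 0 (pi / 2)); rewrite ?in_itv /= ?lexx ?pi2//.
  - move=> x; rewrite in_itv /= => /andP[x0 xpi].
    rewrite derive1E derive_val exprS -{2}[sin x ^+ n]mul1r -mulrBl.
    rewrite mulr_le0_ge0// ?subr_le0 ?sin_le1// exprn_ge0// sin_ge0_pi//.
    rewrite ltW//=; lra.
  - by apply: derivable_within_continuous => x _.
by rewrite /h !fctE !sin_primitive0 subrr subr_le0.
Qed.

(* Equal to 'C(2n, n) / 4 ^ n. *)
Definition cbin {R : realType} (n : nat) : R :=
  \prod_(i < n) ((2 * i + 1)%:R / (2 * i + 2)%:R).

Lemma cbin0 (R : realType) : cbin 0 = 1 :> R.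
Proof. by rewrite /cbin big_ord0. Qed.

Lemma cbinS (R : realType) (n : nat) :
  cbin n.+1 = cbin n * ((2 * n + 1)%:R / (2 * n + 2)%:R) :> R.
Proof. by rewrite /cbin big_ord_recr. Qed.

Lemma cbin_gt0 (R : realType) (n : nat) : 0 < cbin n :> R.
Proof. by apply: prodr_gt0 => i _; rewrite divr_gt0// ltr0n; lia. Qed.

Lemma wallis_even (R : realType) (n : nat) : wallis (2 * n) = pi / 2 * cbin n :> R.
Proof.
elim: n => [|n IH]; first by rewrite cbin0 mulr1.
rewrite (_ : (2 * n.+1 = (2 * n).+2)%N); last by lia.
by rewrite wallisSS IH cbinS addn1 addn2; ring.
Qed.

Lemma wallis_odd (R : realType) (n : nat) :
  wallis (2 * n).+1 = ((2 * n).+1%:R * cbin n)^-1 :> R.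
Proof.
elim: n => [|n IH].
  by rewrite cbin0 mulr1 invr1 /wallis /= cos_pihalf subr0.
rewrite (_ : (2 * n.+1 = (2 * n).+2)%N); last by lia.
rewrite wallisSS IH cbinS addn1 addn2.
have /lt0r_neq0 := cbin_gt0 R n.
move: (cbin n : R) => b b0; field.
by rewrite b0 /=; apply/and3P; split; apply: lt0r_neq0; have := ler0n R n; lra.
Qed.

(** This is the comparison of the Wallis integrals of indices [2n + 1] and [2n]; the next bound
    compares [2n + 2] with [2n + 1]. *)
Lemma cbin_sqr_ge (R : realType) (n : nat) :
  2 <= pi * (2 * n%:R + 1) * cbin n ^+ 2 :> R.
Proof.
have := wallis_nincr R (2 * n); rewrite wallis_even wallis_odd.
have := cbin_gt0 R n; move: (cbin n : R) => b b0.
have n0 : 0 < (2 * n).+1%:R * b by rewrite mulr_gt0.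
rewrite -[_^-1]mul1r ler_pdivrMr// -[(2 * n).+1%:R]natr1 natrM.
by nra.
Qed.

Lemma cbin_sqr_le (R : realType) (n : nat) :
  pi * (2 * n%:R + 1) ^+ 2 * cbin n ^+ 2 <= 4 * (n%:R + 1) :> R.
Proof.
have := wallis_nincr R (2 * n).+1.
rewrite wallisSS wallis_even wallis_odd.
have := cbin_gt0 R n; move: (cbin n : R) => b b0.
have n0 : 0 < (2 * n).+1%:R * b by rewrite mulr_gt0.
rewrite -[leRHS]mul1r ler_pdivlMr// -[(2 * n).+2%:R]natr1 -![(2 * n).+1%:R]natr1 natrM.
have := ler0n R n; set m := n%:R => m0.
have -> : (2 * m + 1) / (2 * m + 1 + 1) * (pi / 2 * b) * ((2 * m + 1) * b) =
    pi * (2 * m + 1) ^+ 2 * b ^+ 2 / (4 * (m + 1)).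
  by field; apply/andP; split; apply: lt0r_neq0; lra.
by rewrite ler_pdivrMr ?mul1r//; lra.
Qed.

Lemma cvg_cbin (R : realType) : (cbin n : R) @[n --> \oo] --> (0 : R).
Proof.
have -> : cbin = (fun n => Num.sqrt (cbin n ^+ 2)) :> (nat -> R).
  by apply/funext => n; rewrite sqrtr_sqr gtr0_norm// cbin_gt0.
rewrite -[X in _ --> X]sqrtr0.
apply: (@cvg_comp _ _ _ (fun n => cbin n ^+ 2 : R) Num.sqrt _ (nbhs (0 : R))); last first.
  exact: sqrt_continuous.
(* Since [pi] is at least 2, the upper Wallis bound gives [cbin n ^+ 2 <= 2 / (n + 1)]. *)
apply: (@squeeze_cvgr _ _ _ _ (cst 0) (2 \*: @harmonic R)).
- near=> n; rewrite sqr_ge0/= /GRing.scale /=.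
  have := cbin_sqr_le R n; have := pi_ge2 R.
  rewrite ler_pdivlMr ?ltr0Sn// -[n.+1%:R]natr1.
  have := ler0n R n; move: (n%:R) (cbin n ^+ 2) (sqr_ge0 (cbin n : R)) => m c c0 m0.
  move: (pi : R) => p h2 h.
  rewrite -(@ler_pM2l _ (m + 1)); last by lra.
  have h3 : 0 <= (p - 2) * ((2 * m + 1) ^+ 2 * c)
    by apply: mulr_ge0; [rewrite subr_ge0|apply: mulr_ge0 => //; exact: sqr_ge0].
  by nra.
- exact: cvg_cst.
- by rewrite -[X in _ --> X](mulr0 2); apply: cvgZl_tmp; apply: cvg_harmonic.
Unshelve. all: end_near. Qed.

Lemma cvg_wallis (R : realType) :
  cbin n * Num.sqrt (pi * n.+1%:R) @[n --> \oo] --> (1 : R).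
Proof.
apply: (@squeeze_cvgr _ _ _ _ (cst 1) (cst 1 + @harmonic R)).
- near=> n; rewrite !fctE /=.
  have b0 := ltW (cbin_gt0 R n); have n0 := ler0n R n; have p0 := pi_ge0 R.
  have e : (cbin n * Num.sqrt (pi * n.+1%:R)) ^+ 2 = pi * (n%:R + 1) * cbin n ^+ 2 :> R.
    by rewrite exprMn sqr_sqrtr ?mulr_ge0// -[n.+1%:R]natr1 mulrC.
  have s0 : 0 <= cbin n * Num.sqrt (pi * n.+1%:R) :> R by rewrite mulr_ge0 ?sqrtr_ge0.
  have := cbin_sqr_ge R n; have := cbin_sqr_le R n.
  rewrite -[n.+1%:R]natr1 in s0 e *.
  set s := cbin n * _ in s0 e *.
  move: s (cbin n ^+ 2 : R) (n%:R : R) (pi : R) n0 p0 s0 e (sqr_ge0 (cbin n : R)).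
  move=> s q m p n0 p0 s0 e q0 h1 h2.
  have sq (x y : R) : 0 <= x -> 0 <= y -> x ^+ 2 <= y ^+ 2 -> x <= y.
    by move=> x0 y0; rewrite ler_pXn2r.
  have t0 : 0 <= p * q by rewrite mulr_ge0.
  apply/andP; split.
    by apply: sq => //; rewrite expr1n e; nra.
  (* The upper Wallis bound thus gives [s <= 1 + 1 / (2m + 1)], which is below [1 + 1 / (m + 1)]. *)
  have h3 : (2 * m + 1) * s <= 2 * (m + 1).
    apply: sq; [by rewrite mulr_ge0//; lra|lra|].
    rewrite exprMn e; have : 0 <= m + 1 by lra.
    by nra.
  rewrite -(@ler_pM2l _ ((2 * m + 1) * (m + 1))); last by nra.
  have -> : (2 * m + 1) * (m + 1) * (1 + (m + 1)^-1) = (2 * m + 1) * (m + 2).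
    by field; apply: lt0r_neq0; lra.
  by nra.
- exact: cvg_cst.
- rewrite -[X in _ --> X](addr0 1); apply: cvgD; first exact: cvg_cst.
  exact: cvg_harmonic.
Unshelve. all: end_near. Qed.

(** * Scaled Catalan numbers and convolutions *)

(* The n-th Catalan number divided by 4 ^ (n + 1). *)
Definition catalan_weight {R : realType} (n : nat) : R := cbin n / (4 * n.+1%:R).

Lemma catalan_weight0 (R : realType) : catalan_weight 0 = 1 / 4 :> R.
Proof. by rewrite /catalan_weight cbin0 mulr1. Qed.

Lemma catalan_weight_gt0 (R : realType) (n : nat) : 0 < catalan_weight n :> R.
Proof. by rewrite divr_gt0 ?mulr_gt0 ?cbin_gt0 ?ltr0Sn. Qed.

(** The Catalan recurrence [(n + 2) C_(n+1) = 2 (2n + 1) C_n], divided by the powers of 4. *)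
Lemma catalan_weightS (R : realType) (n : nat) :
  n.+2%:R * catalan_weight n.+1 = (n%:R + 1 / 2) * catalan_weight n :> R.
Proof.
rewrite /catalan_weight cbinS natrD natrM [(2 * n + 2)%:R]natrD natrM.
rewrite -[n.+2%:R]natr1 -[n.+1%:R]natr1.
have := ler0n R n; move: (n%:R) (cbin n : R) => m b m0.
by field; apply/and3P; split; apply: lt0r_neq0; lra.
Qed.

(** By the symmetry [i <-> n - i], the weight [i] averages to [n / 2]. *)
Lemma sum_conv_index (R : realType) (x : nat -> R) (n : nat) :
  2 * \sum_(i < n.+1) i%:R * (x i * x (n - i)%N) =
  n%:R * \sum_(i < n.+1) x i * x (n - i)%N.
Proof.
rewrite mulr2n mulrDl mul1r {2}(reindex_inj rev_ord_inj) -big_split mulr_sumr /=.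
apply: eq_bigr => i _; rewrite subSS subKn; last by rewrite -ltnS.
have -> : n%:R = (n - i)%:R + i%:R :> R by rewrite -natrD subnK// -ltnS.
by ring.
Qed.

(* With s n the convolution sum, the index-weighted sum gives
   (n+3) s (n+1) = a (n+1) / 2 + (n+1) s n, which is the recurrence of a. *)
Lemma catalan_weight_conv (R : realType) (n : nat) :
  catalan_weight n.+1 = \sum_(i < n.+1) catalan_weight i * catalan_weight (n - i) :> R.
Proof.
set a := @catalan_weight R.
elim: n => [|n IH].
  rewrite big_ord1 subn0; have := catalan_weightS R 0.
  by rewrite -/a /a catalan_weight0; lra.
set s := \sum_(i < n.+2) _.
have hs : n.+3%:R * s = 2 * \sum_(i < n.+2) i.+1%:R * (a i * a (n.+1 - i)%N).
  have -> : \sum_(i < n.+2) i.+1%:R * (a i * a (n.+1 - i)%N) =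
            \sum_(i < n.+2) i%:R * (a i * a (n.+1 - i)%N) + s.
    by rewrite -big_split /=; apply: eq_bigr => i _; rewrite -natr1 mulrDl mul1r.
  rewrite mulrDr sum_conv_index -/s -[n.+3%:R]natr1 -[n.+2%:R]natr1; ring.
have n3 : n.+3%:R != 0 :> R by rewrite pnatr_eq0.
apply: (mulfI n3); rewrite hs catalan_weightS big_ord_recl /= subn0 mul1r.
have -> : \sum_(i < n.+1) (bump 0 i).+1%:R * (a (bump 0 i) * a (n.+1 - bump 0 i)%N) =
          \sum_(i < n.+1) i%:R * (a i * a (n - i)%N) + 1 / 2 * a n.+1.
  rewrite IH mulr_sumr -big_split /=; apply: eq_bigr => i _.
  by rewrite /bump add1n subSS mulrA catalan_weightS /a; ring.
rewrite mul1r !mulrDr sum_conv_index -IH /a catalan_weight0 -[n.+1%:R]natr1; lra.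
Qed.

(** The sum telescopes: each weight is [(cbin n - cbin n.+1) / 2]. *)
Lemma sum_catalan_weight (R : realType) (n : nat) :
  \sum_(i < n) catalan_weight i = (1 - cbin n) / 2 :> R.
Proof.
elim: n => [|n IH]; first by rewrite big_ord0 cbin0 subrr mul0r.
rewrite big_ord_recr /= IH /catalan_weight cbinS natrD natrM [(2 * n + 2)%:R]natrD natrM.
rewrite -[n.+1%:R]natr1; have := ler0n R n; move: (n%:R) (cbin n : R) => m b m0.
by field; apply/andP; split; apply: lt0r_neq0; lra.
Qed.

Lemma cvg_sum_catalan_weight (R : realType) :
  \sum_(i < n) catalan_weight i @[n --> \oo] --> (1 / 2 : R).
Proof.
under eq_fun do rewrite sum_catalan_weight.
rewrite (_ : 1 / 2 = (1 - 0) / 2 :> R); last by rewrite subr0.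
by apply: cvgMr_tmp; apply: cvgB; [exact: cvg_cst|exact: cvg_cbin].
Qed.

Lemma cvg_catalan_weight_ratio (R : realType) :
  catalan_weight n / catalan_weight n.+1 @[n --> \oo] --> (1 : R).
Proof.
have -> : (fun n => catalan_weight n / catalan_weight n.+1) =
    (fun n => 1 + 3 / 2 / (n%:R + 1 / 2)) :> (nat -> R).
  apply/funext => n.
  have := catalan_weightS R n; rewrite -[n.+2%:R]natr1 -[n.+1%:R]natr1.
  have := catalan_weight_gt0 R n; have := catalan_weight_gt0 R n.+1.
  have := ler0n R n; move: (n%:R) (catalan_weight n : R) (catalan_weight n.+1 : R).
  move=> m x y m0 y0 x0 e; apply: (mulIf (lt0r_neq0 y0)); rewrite divfK ?gt_eqF//.
  have m1 : m + 1 / 2 != 0 by apply: lt0r_neq0; lra.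
  apply: (mulfI m1); rewrite -e.
  by field; apply: lt0r_neq0; lra.
rewrite -[X in _ --> X]addr0; apply: cvgD; first exact: cvg_cst.
apply: (@squeeze_cvgr _ _ _ _ (cst 0) (3 \*: @harmonic R)).
- near=> n; have n0 := ler0n R n.
  rewrite divr_ge0 /=; [|lra|lra].
  rewrite /GRing.scale /= -natr1 ler_pdivrMr; last by lra.
  rewrite mulrAC ler_pdivlMr; lra.
- exact: cvg_cst.
- by rewrite -[X in _ --> X](mulr0 3); apply: cvgZl_tmp; apply: cvg_harmonic.
Unshelve. all: end_near. Qed.

(** * Splitting and comparing convolutions *)

Lemma cvg_ratio_shift (R : realType) (a : nat -> R) (i : nat) :
  (forall n, 0 < a n) -> a n / a n.+1 @[n --> \oo] --> (1 : R) ->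
  a (n - i)%N / a n.+1 @[n --> \oo] --> (1 : R).
Proof.
(* Shifting [n] by [i] removes the truncated subtraction; what remains is a product of consecutive
   ratios, each tending to 1. *)
move=> a0 ra; rewrite -(cvg_shiftn i).
under eq_fun do rewrite addnK.
suff H k : a n / a (n + k).+1 @[n --> \oo] --> (1 : R) by exact: H.
elim: k => [|k IH]; first by under eq_fun do rewrite addn0.
have -> : (fun n => a n / a (n + k.+1).+1) =
    (fun n => a n / a (n + k).+1 * (a (n + k.+1)%N / a (n + k.+1).+1)).
  by apply/funext => n; rewrite -(addnS n k) [RHS]mulrA divfK// lt0r_neq0.
rewrite -[X in _ --> X]mulr1; apply: cvgM => //.
by rewrite (cvg_shiftn k.+1 (fun n => a n / a n.+1)).
Qed.

Lemma cvg_sum (R : realType) (M : nat) (x : nat -> nat -> R) (l : nat -> R) :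
  (forall i, x i n @[n --> \oo] --> l i) ->
  \sum_(i < M) x i n @[n --> \oo] --> \sum_(i < M) l i.
Proof.
move=> h; elim: M => [|M IH].
  by under eq_fun do rewrite big_ord0; rewrite big_ord0; apply: cvg_cst.
by under eq_fun do rewrite big_ord_recr; rewrite big_ord_recr; apply: cvgD.
Qed.

(** The first and the last [M] terms are paired, the last ones read backwards; the hypothesis keeps
    the two ends disjoint. *)
Lemma sum_ord_ends (R : realType) (M n : nat) (F : nat -> R) : (2 * M <= n.+1)%N ->
  \sum_(i < n.+1) F i =
  \sum_(i < M) (F i + F (n - i)%N) + \sum_(M <= i < n.+1 - M) F i.
Proof.
move=> le2M; rewrite big_split /= -addrA [X in _ + X]addrC addrA.
rewrite -[LHS](big_mkord xpredT) (@big_cat_nat _ _ _ M)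
  ?(@big_cat_nat _ _ _ (n.+1 - M)%N M n.+1) //=; [|lia|lia|lia].
rewrite big_mkord -addrA; congr (_ + (_ + _)).
rewrite -(big_mkord xpredT (fun i => F (n - i)%N)) big_nat_rev /=.
rewrite -{1}[(n.+1 - M)%N]add0n big_addn (_ : (n.+1 - (n.+1 - M) = M)%N); last by lia.
by apply: eq_big_nat => i ?; congr F; lia.
Qed.

(* The Cauchy product of the partial sums exceeds the triangular sum by the terms
   x i * y j with i + j >= M, which is monotone in x and y. *)
Definition cauchy_defect {R : realType} (x y : nat -> R) (M : nat) : R :=
  (\sum_(i < M) x i) * (\sum_(i < M) y i)
  - \sum_(n < M) \sum_(i < n.+1) x i * y (n - i)%N.

Lemma cauchy_defectE (R : realType) (x y : nat -> R) (M : nat) :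
  cauchy_defect x y M = \sum_(i < M) x i * \sum_(M - i <= j < M) y j.
Proof.
rewrite /cauchy_defect.
(* The triangular sum is rearranged by its first index, so that the difference from the full product
   can be taken row by row. *)
have -> : \sum_(n < M) \sum_(i < n.+1) x i * y (n - i)%N =
          \sum_(i < M) x i * \sum_(0 <= j < M - i) y j.
  elim: M => [|M IH]; first by rewrite !big_ord0.
  rewrite big_ord_recr /= IH [RHS]big_ord_recr /= subSnn big_nat1.
  rewrite [X in _ + X = _]big_ord_recr /= subnn addrA -big_split /=; congr (_ + _).
  apply: eq_bigr => i _; rewrite -mulrDr subSn; last by rewrite ltnW.
  by rewrite big_nat_recr.
rewrite mulr_suml -sumrB; apply: eq_bigr => i _.
rewrite -mulrBr -[\sum_(i < M) y i](big_mkord xpredT).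
by rewrite (@big_cat_nat _ _ _ (M - i)%N) ?leq_subr//= addrAC subrr add0r.
Qed.

Lemma cauchy_defect_ge0 (R : realType) (x y : nat -> R) (M : nat) :
  (forall i, 0 <= x i) -> (forall i, 0 <= y i) -> 0 <= cauchy_defect x y M.
Proof.
move=> x0 y0; rewrite cauchy_defectE; apply: sumr_ge0 => i _.
by rewrite mulr_ge0// sumr_ge0.
Qed.

Lemma le_cauchy_defect (R : realType) (x y z : nat -> R) (M : nat) :
  (forall i, 0 <= x i <= z i) -> (forall i, 0 <= y i <= z i) ->
  cauchy_defect x y M <= cauchy_defect z z M.
Proof.
move=> xz yz; rewrite !cauchy_defectE; apply: ler_sum => i _.
have /andP[x0 xzi] := xz i; apply: ler_pM => //.
  by apply: sumr_ge0 => j _; case/andP: (yz j).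
by apply: ler_sum => j _; case/andP: (yz j).
Qed.

(** Replaces an argument with the limit superior: starting from the bound 1, iterated halving brings
    [r] eventually below every power of 1/2. *)
Lemma cvg0_halving (R : realType) (r : nat -> R) :
  (forall n, 0 <= r n <= 1) ->
  (forall L, 0 < L -> (\forall n \near \oo, r n <= L) ->
     \forall n \near \oo, r n <= L / 2) ->
  r n @[n --> \oo] --> (0 : R).
Proof.
move=> r01 halve.
have pow k : \forall n \near \oo, r n <= 1 / 2 ^+ k.
  elim: k => [|k IH].
    by near=> n; rewrite expr0 divr1; case/andP: (r01 n).
  rewrite exprSr invfM mulrA; apply: halve IH.
  by rewrite divr_gt0 ?exprn_gt0.
apply/cvgr0Pnorm_le => e e0.
have := @cvg_geometric R 1 (1 / 2).
rewrite ger0_norm ?divr_ge0// => /(_ ltac:(lra)) /cvgr0_norm_le /(_ e e0) [k _ /(_ k (leqnn k))].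
rewrite /geometric /= !mul1r exprVn -[_^-1]mul1r ger0_norm ?divr_ge0 ?exprn_ge0// => hk.
apply: filterS (pow k) => n hn; have /andP[rn _] := r01 n.
by rewrite ger0_norm// (le_trans hn).
Unshelve. all: end_near. Qed.

(** * Asymptotic proportions *)

(** The base 12 is 3 truth values per leaf times the Catalan growth rate 4. The index shift makes
    convolutions start at 0. *)
Definition scaled {R : realType} (c : nat -> nat) (n : nat) : R :=
  (c n.+1)%:R / 12 ^+ n.+1.

Lemma scaled_ge0 (R : realType) (c : nat -> nat) (n : nat) : 0 <= scaled c n :> R.
Proof. by rewrite divr_ge0// exprn_ge0. Qed.

Lemma scaled_conv (R : realType) (x y z : nat -> nat) (n : nat) :
  z n.+2 = (\sum_(i < n.+1) x i.+1 * y (n - i).+1)%N ->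
  scaled z n.+1 = \sum_(i < n.+1) scaled x i * scaled y (n - i) :> R.
Proof.
move=> e; rewrite /scaled e natr_sum mulr_suml; apply: eq_bigr => i _.
rewrite natrM mulrACA -invfM -exprD; congr (_ / 12 ^+ _).
by have := ltn_ord i; lia.
Qed.

Lemma scaled_g (R : realType) (n : nat) : scaled g_ n = catalan_weight n :> R.
Proof.
elim/ltn_ind: n => -[_|n IH].
  by rewrite catalan_weight0 /scaled g_1 expr1; lra.
rewrite (scaled_conv R (g_SS n)) catalan_weight_conv; apply: eq_bigr => i _.
by rewrite !IH// ltnS ?leq_subr// -ltnS.
Qed.

Lemma scaled_u (R : realType) (n : nat) : scaled u_ n = catalan_weight n / 3 :> R.
Proof. by rewrite -scaled_g /scaled g_eq3u// natrM mulrAC [3 * _]mulrC mulfK. Qed.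

Lemma scaled_f_add_t (R : realType) (n : nat) :
  scaled f_ n + scaled t_ n = 2 / 3 * catalan_weight n :> R.
Proof.
have : scaled f_ n + scaled t_ n + scaled u_ n = scaled g_ n :> R.
  by rewrite /scaled g_sum !natrD !mulrDl.
by rewrite scaled_u scaled_g; lra.
Qed.

Lemma scaled_f0 (R : realType) : scaled f_ 0 = 1 / 12 :> R.
Proof. by rewrite /scaled f_1 expr1. Qed.

Lemma scaled_fS (R : realType) (n : nat) :
  scaled f_ n.+1 = \sum_(i < n.+1) scaled t_ i * scaled f_ (n - i) :> R.
Proof. exact: (scaled_conv R (f_SS n)). Qed.

Lemma scaled_f_le (R : realType) (n : nat) : scaled f_ n <= catalan_weight n :> R.
Proof.
have := scaled_f_add_t R n; have := scaled_ge0 R t_ n.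
by have := catalan_weight_gt0 R n; lra.
Qed.

Lemma scaled_t_le (R : realType) (n : nat) : scaled t_ n <= catalan_weight n :> R.
Proof.
have := scaled_f_add_t R n; have := scaled_ge0 R f_ n.
by have := catalan_weight_gt0 R n; lra.
Qed.

Lemma sum_scaled_t (R : realType) (M : nat) :
  \sum_(i < M) scaled t_ i =
  2 / 3 * \sum_(i < M) catalan_weight i - \sum_(i < M) scaled f_ i :> R.
Proof.
rewrite mulr_sumr -sumrB; apply: eq_bigr => i _.
by rewrite -scaled_f_add_t addrAC subrr add0r.
Qed.

Lemma sumS_conv (R : realType) (x y z : nat -> R) (M : nat) :
  (forall n, z n.+1 = \sum_(i < n.+1) x i * y (n - i)%N) ->
  \sum_(n < M) \sum_(i < n.+1) x i * y (n - i)%N = \sum_(i < M.+1) z i - z 0%N.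
Proof.
move=> e; rewrite big_ord_recl /= addrAC subrr add0r.
by apply: eq_bigr => i _; rewrite e.
Qed.

Lemma sqrt7_bounds (R : realType) :
  let s : R := Num.sqrt 7 in [/\ s ^+ 2 = 7, 2 < s & s < 3].
Proof.
move=> s; have s2 : s ^+ 2 = 7 by rewrite sqr_sqrtr.
have s0 : 0 <= s by rewrite sqrtr_ge0.
by split=> //; nra.
Qed.

(* Letting M tend to infinity in the recurrence summed up to M gives
   F = 1/12 + (1/3 - F) F for the limit F. *)
Lemma cvg_sum_scaled_f (R : realType) :
  \sum_(i < M) scaled f_ i @[M --> \oo] --> ((Num.sqrt 7 - 2) / 6 : R).
Proof.
pose F M : R := \sum_(i < M) scaled f_ i.
pose A M : R := \sum_(i < M) catalan_weight i.
have cA : A M @[M --> \oo] --> (1 / 2 : R) by exact: cvg_sum_catalan_weight.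
have cAS : A M.+1 @[M --> \oo] --> (1 / 2 : R) by rewrite (cvg_shiftS A).
have A12 M : A M <= 1 / 2.
  by rewrite /A sum_catalan_weight; have := cbin_gt0 R M; lra.
have FA M : F M <= A M by apply: ler_sum => i _; exact: scaled_f_le.
have cF0 : cvgn F.
  apply: nondecreasing_is_cvgn.
    apply/nondecreasing_seqP => n; rewrite /F big_ord_recr /= lerDl.
    exact: scaled_ge0.
  by exists (1 / 2) => _ [n _ <-]; exact: le_trans (FA n) (A12 n).
have [l cF] : exists l : R, F M @[M --> \oo] --> l by exists (limn F).
have cFS : F M.+1 @[M --> \oo] --> l by rewrite (cvg_shiftS F).
have l0 : 0 <= l.
  rewrite -(cvg_lim _ cF)//; apply: limr_ge => //; near=> n.
  by apply: sumr_ge0 => i _; exact: scaled_ge0.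
have dE M : cauchy_defect (scaled t_) (scaled f_) M =
    (2 / 3 * A M - F M) * F M - (F M.+1 - 1 / 12).
  by rewrite /cauchy_defect (sumS_conv M (scaled_fS R)) sum_scaled_t scaled_f0.
have aE M : cauchy_defect catalan_weight catalan_weight M = A M * A M - (A M.+1 - 1 / 4).
  by rewrite /cauchy_defect (sumS_conv M (catalan_weight_conv R)) catalan_weight0.
have cD : (2 / 3 * A M - F M) * F M - (F M.+1 - 1 / 12) @[M --> \oo] --> (0 : R).
  (* The defect of [t] and [f] is dominated by that of the Catalan weights, which vanishes in the
     limit because 1/2 solves [A = 1/4 + A * A]. *)
  apply: (@squeeze_cvgr _ _ _ _ (cst 0) (fun M => A M * A M - (A M.+1 - 1 / 4))).
  - near=> M; rewrite -dE -aE cauchy_defect_ge0 /=; try exact: scaled_ge0.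
    by apply: le_cauchy_defect => i; rewrite scaled_ge0 ?scaled_f_le ?scaled_t_le.
  - exact: cvg_cst.
  - rewrite (_ : 0 = 1 / 2 * (1 / 2) - (1 / 2 - 1 / 4) :> R); last by lra.
    apply: cvgB; first exact: cvgM.
    by apply: cvgB => //; exact: cvg_cst.
have cD' : (2 / 3 * A M - F M) * F M - (F M.+1 - 1 / 12) @[M --> \oo] -->
    ((2 / 3 * (1 / 2) - l) * l - (l - 1 / 12)).
  apply: cvgB; last by apply: cvgB => //; exact: cvg_cst.
  by apply: cvgM => //; apply: cvgB => //; apply: cvgMl_tmp.
have e : 0 = (2 / 3 * (1 / 2) - l) * l - (l - 1 / 12) :> R.
  by rewrite -(cvg_lim _ cD')//; apply/esym/cvg_lim.
have [s2 s2l _] := sqrt7_bounds R.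
suff <- : l = (Num.sqrt 7 - 2) / 6 by [].
move: (Num.sqrt 7 : R) s2 s2l => s s2 s2l.
(* The quadratic [l ^+ 2 + 2 / 3 * l - 1 / 12 = 0] in factored form; its other root is negative,
   whereas [l] is not. *)
have : (l - (s - 2) / 6) * (l + (s + 2) / 6) = 0.
  have -> : (l - (s - 2) / 6) * (l + (s + 2) / 6) = l ^+ 2 + 2 / 3 * l - (s ^+ 2 - 4) / 36 by field.
  by rewrite s2; lra.
move=> /eqP; rewrite mulf_eq0 => /orP[|] /eqP; lra.
Unshelve. all: end_near. Qed.

(** The solution [c] of [c = c * T + (2 / 3 - c) * F], where [F] is the sum of the scaled [f] and
    [T = 1 / 3 - F] that of the scaled [t]. *)
Definition false_ratio {R : realType} : R := (7 - 2 * Num.sqrt 7) / 21.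

(** Here [w i] stands for [a (n - i) / a n.+1]. The first summand measures how far the end terms
    miss the proportion [false_ratio], the second is the share of the middle terms in the
    convolution of [a]. *)
Definition end_error {R : realType} (w : nat -> R) (M : nat) : R :=
  `|\sum_(i < M) (false_ratio * scaled t_ i + (2 / 3 - false_ratio) * scaled f_ i) * w i
    - false_ratio| + (1 - 2 * \sum_(i < M) catalan_weight i * w i).

(** The first summand vanishes in the limit by the fixed-point equation of [false_ratio], the second
    because the weights sum to 1/2. *)
Lemma cvg_end_error1 (R : realType) : end_error (fun=> 1) M @[M --> \oo] --> (0 : R).
Proof.
have [s2 _ _] := sqrt7_bounds R.
have cA := @cvg_sum_catalan_weight R; have cF := @cvg_sum_scaled_f R.
set c : R := false_ratio; set F : R := (Num.sqrt 7 - 2) / 6 in cF.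
have -> : end_error (fun=> 1) = (fun M => `|c * (2 / 3 * \sum_(i < M) catalan_weight i
    - \sum_(i < M) scaled f_ i) + (2 / 3 - c) * \sum_(i < M) scaled f_ i - c|
    + (1 - 2 * \sum_(i < M) catalan_weight i)) :> (nat -> R).
  apply/funext => M; rewrite /end_error -/c.
  congr (`|_ - _| + (1 - 2 * _)); last by apply: eq_bigr => i _; rewrite mulr1.
  by rewrite -sum_scaled_t !mulr_sumr -big_split; apply: eq_bigr => i _; rewrite mulr1.
have e : `|c * (2 / 3 * (1 / 2) - F) + (2 / 3 - c) * F - c| + (1 - 2 * (1 / 2)) = 0 :> R.
  have -> : c * (2 / 3 * (1 / 2) - F) + (2 / 3 - c) * F - c = 0.
    rewrite /c /F /false_ratio; move: (Num.sqrt 7 : R) s2 => s s2.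
    transitivity (2 / 63 * (s ^+ 2 - 7)); first by field.
    by rewrite s2 subrr mulr0.
  by rewrite normr0; lra.
rewrite -[X in _ --> X]e; apply: cvgD.
  apply: cvg_norm; apply: cvgB; last exact: cvg_cst.
  apply: cvgD; last exact: cvgMl_tmp.
  by apply: cvgMl_tmp; apply: cvgB => //; apply: cvgMl_tmp.
by apply: cvgB; [exact: cvg_cst|exact: cvgMl_tmp].
Qed.

Lemma cvg_end_error (R : realType) (M : nat) :
  end_error (fun i => catalan_weight (n - i) / catalan_weight n.+1) M @[n --> \oo]
  --> (end_error (fun=> 1) M : R).
Proof.
have cw (v : nat -> R) :
    \sum_(i < M) v i * (catalan_weight (n - i) / catalan_weight n.+1) @[n --> \oo] -->
    \sum_(i < M) v i * 1.
  apply: (@cvg_sum R M (fun i n => v i * (catalan_weight (n - i) / catalan_weight n.+1))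
    (fun i => v i * 1)) => i.
  apply: cvgMl_tmp; apply: cvg_ratio_shift; first exact: catalan_weight_gt0.
  exact: cvg_catalan_weight_ratio.
apply: cvgD.
  apply: cvg_norm; apply: cvgB; last exact: cvg_cst.
  exact: (cw (fun i => false_ratio * scaled t_ i + (2 / 3 - false_ratio) * scaled f_ i)).
by apply: cvgB; [exact: cvg_cst|apply: cvgMl_tmp; exact: cw].
Qed.

Definition false_gap {R : realType} (n : nat) : R :=
  `|scaled f_ n - false_ratio * catalan_weight n|.

(* A pair of end terms of the convolution of t and f contributes the same pair
   of terms with f, t replaced by their proportional parts, up to (t - f) times
   the gap; the factor 1/3 arises since t + f = (2/3) a and the two ends of the
   convolution of a carry equal mass. *)
Lemma false_gap_step (R : realType) (M n : nat) (L : R) : (2 * M <= n.+1)%N ->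
  (forall i, (i < M)%N -> false_gap (n - i) <= L * catalan_weight (n - i)) ->
  0 <= L ->
  false_gap n.+1 <= catalan_weight n.+1 *
    (L / 3 + end_error (fun i => catalan_weight (n - i) / catalan_weight n.+1) M).
Proof.
move=> leM gapL L0; set a : nat -> R := catalan_weight; set c : R := false_ratio.
set f : nat -> R := scaled f_; set t : nat -> R := scaled t_.
pose w i := c * t i + (2 / 3 - c) * f i.
pose P := \sum_(i < M) a i * a (n - i)%N.
have a0 i : 0 < a i by exact: catalan_weight_gt0.
have f0 i : 0 <= f i by exact: scaled_ge0.
have t0 i : 0 <= t i by exact: scaled_ge0.
have ft i : f i + t i = 2 / 3 * a i by exact: scaled_f_add_t.
pose midf := \sum_(M <= i < n.+1 - M) t i * f (n - i)%N.
pose mida := \sum_(M <= i < n.+1 - M) a i * a (n - i)%N.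
have endsym (x y : nat -> R) i : (i < M)%N -> x (n - i)%N * y (n - (n - i))%N = x (n - i)%N * y i.
  by move=> iM; rewrite subKn//; lia.
(* The middle terms are not estimated one by one: [midf] lies between 0 and [mida], which is what
   the two ends leave of [a n.+1]. *)
have midaE : mida = a n.+1 - 2 * P.
  rewrite {1}/a catalan_weight_conv (sum_ord_ends (fun i => a i * a (n - i)%N) leM) -/mida.
  have -> : \sum_(i < M) (a i * a (n - i)%N + a (n - i)%N * a (n - (n - i))%N) = 2 * P.
    by rewrite mulr_sumr; apply: eq_bigr => i _; rewrite endsym//; ring.
  by ring.
have midf0 : 0 <= midf by apply: sumr_ge0 => i _; rewrite mulr_ge0.
have midfa : midf <= mida.
  by apply: ler_sum => i _; apply: ler_pM => //; [exact: scaled_t_le|exact: scaled_f_le].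
have fE : f n.+1 - c * a n.+1 = (\sum_(i < M) w i * a (n - i)%N - c * a n.+1)
    + \sum_(i < M) (t i - f i) * (f (n - i)%N - c * a (n - i)%N) + midf.
  rewrite {1}/f scaled_fS (sum_ord_ends (fun i => t i * f (n - i)%N) leM) -/midf.
  have -> : \sum_(i < M) (t i * f (n - i)%N + t (n - i)%N * f (n - (n - i))%N) =
      \sum_(i < M) w i * a (n - i)%N + \sum_(i < M) (t i - f i) * (f (n - i)%N - c * a (n - i)%N).
    rewrite -big_split /=; apply: eq_bigr => i _; rewrite endsym//.
    have -> : t (n - i)%N = 2 / 3 * a (n - i)%N - f (n - i)%N.
      by rewrite -ft addrAC subrr add0r.
    by rewrite /w; ring.
  by ring.
have gaps : `|\sum_(i < M) (t i - f i) * (f (n - i)%N - c * a (n - i)%N)| <= L * (2 / 3 * P).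
  apply: le_trans (ler_norm_sum _ _ _) _; rewrite !mulr_sumr; apply: ler_sum => i _.
  rewrite normrM (_ : L * _ = (2 / 3 * a i) * (L * a (n - i)%N)); last by ring.
  apply: ler_pM => //; last exact: gapL.
  by rewrite -ft ler_norml; have := f0 i; have := t0 i; lra.
(* As [mida] is nonnegative, [P] is at most half of [a n.+1], which turns 2/3 into 1/3. *)
have LP : L * (2 / 3 * P) <= L / 3 * a n.+1.
  rewrite (_ : L / 3 * _ = L * (a n.+1 / 3)); last by ring.
  by apply: ler_wpM2l => //; have := le_trans midf0 midfa; rewrite midaE; lra.
have errE : a n.+1 * end_error (fun i => a (n - i)%N / a n.+1) M =
    `|\sum_(i < M) w i * a (n - i)%N - c * a n.+1| + mida.
  have an := lt0r_neq0 (a0 n.+1).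
  have out (v : nat -> R) : a n.+1 * \sum_(i < M) v i * (a (n - i)%N / a n.+1) =
      \sum_(i < M) v i * a (n - i)%N.
    by rewrite mulr_sumr; apply: eq_bigr => i _; rewrite mulrCA [a n.+1 * _]mulrC divfK.
  rewrite /end_error -/c mulrDr; congr (_ + _).
    by rewrite -{1}(gtr0_norm (a0 n.+1)) -normrM mulrBr (out w) [a n.+1 * c]mulrC.
  by rewrite midaE /P -(out a); ring.
rewrite /false_gap -/a -/f -/c fE mulrDr -/a errE.
apply: le_trans (ler_normD _ _) _; rewrite [`|midf|]ger0_norm//.
rewrite addrA; apply: lerD => //.
apply: le_trans (ler_normD _ _) _; rewrite addrC; apply: lerD => //.
by apply: le_trans gaps _; rewrite mulrC in LP *; rewrite [leRHS]mulrC.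
Qed.

Lemma cvg_false_ratio (R : realType) :
  scaled f_ n / catalan_weight n @[n --> \oo] --> (false_ratio : R).
Proof.
have [s2 s2l s3] := sqrt7_bounds R.
have a0 n : 0 < catalan_weight n :> R by exact: catalan_weight_gt0.
have gapE n : `|scaled f_ n / catalan_weight n - false_ratio| =
              false_gap n / catalan_weight n :> R.
  by rewrite /false_gap -[X in _ = _ / X](gtr0_norm (a0 n)) -normf_div mulrBl mulfK ?lt0r_neq0.
suff gap0 : false_gap n / catalan_weight n @[n --> \oo] --> (0 : R).
  apply/cvgrPdist_le => e e0; near=> n.
  rewrite distrC gapE.
  have : `|false_gap n / catalan_weight n| <= e :> R.
    by near: n; exact: cvgr0_norm_le.
  exact: le_trans (ler_norm _).
apply: cvg0_halving => [n|L L0 [N _ hN]].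
  rewrite -gapE normr_ge0 /=.
  have : 0 <= (scaled f_ n : R) / catalan_weight n <= 2 / 3.
    apply/andP; split; first by apply: divr_ge0; [exact: scaled_ge0|exact: ltW].
    rewrite ler_pdivrMr// -scaled_f_add_t lerDl.
    exact: scaled_ge0.
  move: (scaled f_ n / _) => r /andP[r0 r1].
  by rewrite ler_norml /false_ratio; lra.
have gapL n : (N <= n)%N -> false_gap n <= L * catalan_weight n.
  by move=> /hN /=; rewrite ler_pdivrMr.
(* An end error below [L / 6] suffices, since [L / 3 + L / 6 = L / 2]. First [M] is fixed using the
   limit weights 1, then [n] is taken large for the actual weights. *)
have L6 : 0 < L / 6 by lra.
have [M _ /(_ M (leqnn M)) /= hM] := cvgr_lt _ (@cvg_end_error1 R) _ L6.
have herr := cvgr_lt _ (@cvg_end_error R M) _ hM.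
suff : \forall n \near \oo, false_gap n.+1 / catalan_weight n.+1 <= L / 2 :> R.
  by case=> K _ hK; exists K.+1 => // -[//|n] /hK.
near=> n.
rewrite ler_pdivrMr// mulrC.
apply: le_trans (@false_gap_step R M n L _ _ _) _.
- near: n; exists (2 * M)%N => // n /= ?; lia.
- move=> i iM; apply: gapL.
  (* This keeps every index [n - i] with [i < M] in the range where the bound [L] holds. *)
  suff : (N + M <= n)%N by lia.
  by near: n; exists (N + M)%N.
- exact: ltW.
rewrite ler_pM2l//.
have : end_error (fun i => catalan_weight (n - i) / catalan_weight n.+1) M < L / 6 :> R.
  by near: n; exact: herr.
by lra.
Unshelve. all: end_near. Qed.

(** * From scaled counts to the asymptotic formulas *)

Definition catalan_asymptotics {R : realType} (n : nat) : R :=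
  3 * 12 ^+ (n - 1) / Num.sqrt (pi * n%:R ^+ 3).

Lemma catalan_asymptotics_gt0 (R : realType) (n : nat) :
  0 < catalan_asymptotics n.+1 :> R.
Proof.
by rewrite divr_gt0 ?mulr_gt0 ?exprn_gt0// sqrtr_gt0 mulr_gt0 ?pi_gt0// exprn_gt0.
Qed.

Lemma cvg_catalan_asymptotics (R : realType) :
  catalan_weight n * 12 ^+ n.+1 / catalan_asymptotics n.+1 @[n --> \oo] --> (1 : R).
Proof.
(* The powers of 12 and the factor [n.+1] taken out of the square root cancel exactly, leaving the
   Wallis quantity. *)
have -> : (fun n => catalan_weight n * 12 ^+ n.+1 / catalan_asymptotics n.+1) =
    (fun n => cbin n * Num.sqrt (pi * n.+1%:R)) :> (nat -> R).
  apply/funext => n; rewrite /catalan_asymptotics /catalan_weight subn1 /= exprS.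
  have -> : Num.sqrt (pi * n.+1%:R ^+ 3) = n.+1%:R * Num.sqrt (pi * n.+1%:R) :> R.
    rewrite (_ : pi * _ = n.+1%:R ^+ 2 * (pi * n.+1%:R)); last by ring.
    by rewrite sqrtrM ?sqr_ge0// sqrtr_sqr ger0_norm.
  have n0 : n.+1%:R != 0 :> R by rewrite pnatr_eq0.
  have s0 : Num.sqrt (pi * n.+1%:R) != 0 :> R.
    by rewrite sqrtr_eq0 -ltNge mulr_gt0 ?pi_gt0.
  have e0 : 12 ^+ n != 0 :> R by rewrite expf_neq0// pnatr_eq0.
  move: (n.+1%:R : R) (Num.sqrt _ : R) (12 ^+ n : R) (cbin n : R) n0 s0 e0.
  by move=> m s e b n0 s0 e0; field; rewrite n0 s0 e0.
exact: cvg_wallis.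
Qed.

Lemma asymptotic_scaled (R : realType) (c : nat -> nat) (l : R) : l != 0 ->
  scaled c n / catalan_weight n @[n --> \oo] --> l ->
  asymptotic (fun n => (c n)%:R) (fun n => l * catalan_asymptotics n).
Proof.
move=> l0 cl; rewrite /asymptotic -cvg_shiftS /=.
have -> : (fun n => (c n.+1)%:R / (l * catalan_asymptotics n.+1)) =
    (fun n => l^-1 * (scaled c n / catalan_weight n) *
              (catalan_weight n * 12 ^+ n.+1 / catalan_asymptotics n.+1)).
  apply/funext => n; rewrite /scaled.
  have a0 := lt0r_neq0 (catalan_weight_gt0 R n).
  have g0 := lt0r_neq0 (catalan_asymptotics_gt0 R n).
  have e0 : 12 ^+ n.+1 != 0 :> R by rewrite expf_neq0// pnatr_eq0.
  by move: (12 ^+ n.+1 : R) e0 => e e0; field; rewrite a0 g0 e0 l0.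
have := cvgM (@cvgMl_tmp _ _ _ _ _ l^-1 _ cl) (@cvg_catalan_asymptotics R).
by rewrite mulVf// mulr1; apply.
Qed.

Theorem theorem6 (R : realType) :
  [/\ asymptotic (fun n => (f_ n)%:R : R)
        (fun n => (7 - 2 * Num.sqrt 7) / 21 *
                  (3 * 12 ^+ (n - 1) / Num.sqrt (pi * n%:R ^+ 3))),
      asymptotic (fun n => (t_ n)%:R : R)
        (fun n => (7 + 2 * Num.sqrt 7) / 21 *
                  (3 * 12 ^+ (n - 1) / Num.sqrt (pi * n%:R ^+ 3))),
      asymptotic (fun n => (u_ n)%:R : R)
        (fun n => 1 / 3 *
                  (3 * 12 ^+ (n - 1) / Num.sqrt (pi * n%:R ^+ 3))) &
      asymptotic (fun n => (g_ n)%:R : R)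
        (fun n => 3 * 12 ^+ (n - 1) / Num.sqrt (pi * n%:R ^+ 3))].
Proof.
have [s2 s2l s3] := sqrt7_bounds R.
have a0 n : catalan_weight n != 0 :> R by apply/lt0r_neq0/catalan_weight_gt0.
split.
- apply: asymptotic_scaled; first by apply: lt0r_neq0; lra.
  exact: cvg_false_ratio.
- apply: asymptotic_scaled; first by apply: lt0r_neq0; lra.
  (* The proportion of true rows is the complement of [false_ratio] in 2/3, the share of all rows
     that are not unknown. *)
  have -> : (fun n => scaled t_ n / catalan_weight n) =
      (fun n => 2 / 3 - scaled f_ n / catalan_weight n) :> (nat -> R).
    apply/funext => n; rewrite -[2 / 3](mulfK (a0 n)) -mulrBl -scaled_f_add_t.
    by rewrite addrAC subrr add0r.
  rewrite (_ : _ / 21 = 2 / 3 - false_ratio); last by rewrite /false_ratio; lra.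
  by apply: cvgB; [exact: cvg_cst|exact: cvg_false_ratio].
- apply: asymptotic_scaled; first by apply: lt0r_neq0; lra.
  under eq_fun do rewrite scaled_u mulrAC divff// .
  exact: cvg_cst.
- rewrite (_ : (fun n => 3 * _ / _) = (fun n => 1 * catalan_asymptotics n)); last first.
    by apply/funext => n; rewrite mul1r.
  apply: asymptotic_scaled; first exact: oner_neq0.
  under eq_fun do rewrite scaled_g divff//.
  exact: cvg_cst.
Qed.
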